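(* Let $(E,g)$ be a spacetime and let $K$ be a (general, i.e. not necessarily linear) spacetime connection on $TE\to E$. Then $g$ and $K$ induce on $TE$ natural symplectic and Poisson structures, i.e. the 2-form $\Upsilon[g,K]$ is symplectic (closed and non-degenerate) and the 2-vector $\Lambda[g,K]$ is Poisson ($[\Lambda[g,K],\Lambda[g,K]]=0$ for the Schouten bracket), if and only if both of the conditions $$L[I]\,L[K]\,g^\flat=0\qquad\text{and}\qquad L[K]\,L[K]\,g^\flat=0$$ are satisfied.
   Context: Spacetime: $E$ is an oriented and time-oriented smooth 4-dimensional manifold with a scaled Lorentzian metric $g:E\to\mathbb L^2\otimes T^*E\otimes T^*E$ of signature $(-+++)$. Here $\mathbb L$ is the space of lengths (a one-dimensional positive space, algebraically like $\mathbb R^+$ but with no distinguished basis), $\mathbb L^p=\otimes^p\mathbb L$; after choosing a unit of length, scaled objects become ordinary tensors ($g$ an ordinary Lorentzian metric), and none of the conditions here depends on the unit. The dual metric is $\bar g=g^{\lambda\mu}\partial_\lambda\otimes\partial_\mu$. Coordinates: a chart $(x^\lambda)$ of $E$ induces $(x^\lambda,\dot x^\lambda)$ on $TE$, with local bases $(\partial_\lambda,\dot\partial_\lambda)$ of $TTE$ and $(d^\lambda,\dot d^\lambda)$ of $T^*TE$. The Einstein summation convention is used. A (general) spacetime connection is a smooth connection $K$ of the bundle $TE\to E$, $K=d^\lambda\otimes(\partial_\lambda+K_\lambda{}^\nu\dot\partial_\nu)$ with $K_\lambda{}^\nu$ smooth functions on $TE$ (zero section included). As a tangent-valued 1-form on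 $TE$, $K$ is the horizontal projector $TTE\to TTE$. Lie derivative: for a form $\phi$ on $TE$ of degree $r$, $L[K]\phi=i(K)d\phi-d\,i(K)\phi$, where $(i(K)\phi)(A_1,\dots,A_r)=\sum_j\phi(A_1,\dots,K(A_j),\dots,A_r)$. $L[I]=i(I)d+d\,i(I)$ is the usual Lie derivative along the Liouville vector field $I=\dot x^\lambda\dot\partial_\lambda$ on $TE$. $g^\flat=g_{\lambda\mu}\dot x^\lambda d^\mu$ is the (scaled) 1-form on $TE$ given by the musical map of $g$. Spacetime 2-form: $\Upsilon[g,K]=g_{\lambda\mu}(\dot d^\lambda-K_\nu{}^\lambda d^\nu)\wedge d^\mu$ on $TE$ (values in $\mathbb L^2\otimes\Lambda^2T^*TE$). Spacetime 2-vector: $\Lambda[g,K]=g^{\lambda\mu}(\partial_\lambda+K_\lambda{}^\nu\dot\partial_\nu)\wedge\dot\partial_\mu$ on $TE$ (values in $\mathbb L^{*2}\otimes\Lambda^2TTE$). Both are globally defined. *)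

(* Defs.v *)
From HB Require Import structures.
From mathcomp Require Import all_boot all_order all_algebra.
From mathcomp Require Import all_classical all_reals all_analysis.
Set Implicit Arguments.
Unset Strict Implicit.
Unset Printing Implicit Defensive.
Import Order.TTheory GRing.Theory Num.Theory.
Import numFieldNormedType.Exports.
Local Open Scope classical_set_scope.
Local Open Scope ring_scope.

Section Calculus.
Context {R : realType}.

(* C^infinity on the open set U; intended for V of finite dimension, where
   this amounts to all iterated partial derivatives being differentiable *)
Definition smooth_on {V W : normedModType R} (U : set V) (f : V -> W) :=
  forall (s : seq V) (x : V), U x ->
    differentiable (foldr (fun v h => 'D_v h) f s) x.

Context {V : normedModType R}.

(* Tensor fields on an open subset of V are total functions on V; only their
   values on that open subset matter. An r-form is evaluated on r constant
   vectors. All forms to which d is applied below are alternating. *)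
Definition form (r : nat) := V -> ('I_r -> V) -> R.

(* (dphi)(A_0, .., A_r)
     = sum_i (-1)^i A_i.phi(A_0, .., A_(i-1), A_(i+1), .., A_r)
   for constant A_i; with this convention
   (alpha /\ beta)(A, B) = alpha(A) beta(B) - alpha(B) beta(A) *)
Definition extd r (phi : form r) : form r.+1 := fun z A =>
  \sum_(i < r.+1)
    (-1) ^+ i * 'D_(A i) (fun y => phi y (fun j => A (lift i j))) z.

Definition wedge (a b : V -> R) (A : 'I_2 -> V) : R :=
  a (A ord0) * b (A ord_max) - a (A ord_max) * b (A ord0).

Definition iota_vec (X : V -> V) r (phi : form r.+1) : form r := fun z A =>
  phi z (fun k => if unlift ord0 k is Some j then A j else X z).

(* N z is the endomorphism of the tangent space V at z given by a
   tangent-valued 1-form N *)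
Definition iota_tv (N : V -> V -> V) r (phi : form r) : form r := fun z A =>
  \sum_(j < r) phi z (fun k => if k == j then N z (A k) else A k).

Definition lie_vec (X : V -> V) r (phi : form r.+1) : form r.+1 := fun z A =>
  iota_vec X (extd phi) z A + extd (iota_vec X phi) z A.

Definition lie_tv (N : V -> V -> V) r (phi : form r) : form r.+1 := fun z A =>
  iota_tv N (extd phi) z A - extd (iota_tv N phi) z A.

(* A 2-vector field P is encoded by its contractions P z a = P_z(a, .), the
   vector such that P_z(a, b) = b (P z a). *)
Definition bivector := V -> {scalar V} -> V.

Definition vwedge (u v : V) (a : {scalar V}) : V := a u *: v - a v *: u.

(* [P, Q]^{abc} = sum over cyclic permutations of (a, b, c) of
                  P^{ad} d_d Q^{bc} + Q^{ad} d_d P^{bc},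
   evaluated on constant covectors a, b, c. It is characterized by
   [X /\ Y, Z /\ W] = [X, Z] /\ Y /\ W - [X, W] /\ Y /\ Z
                      - [Y, Z] /\ X /\ W + [Y, W] /\ X /\ Z. *)
Definition schouten (P Q : bivector) (z : V) (a b c : {scalar V}) : R :=
  let S (a b c : {scalar V}) :=
    'D_(P z a) (fun y => c (Q y b)) z + 'D_(Q z a) (fun y => c (P y b)) z in
  S a b c + S b c a + S c a b.

End Calculus.

Arguments form {R} V r.
Arguments bivector {R} V.

Section Manifold.
Context {R : realType} (n : nat) (E : topologicalType).

(* the values of chart_inv outside chart_image are irrelevant *)
Record chart := Chart {
  chart_dom : set E;
  chart_map : E -> 'rV[R]_n;
  chart_inv : 'rV[R]_n -> E;
  chart_dom_open : open chart_dom;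
  chart_image_open : open (chart_map @` chart_dom);
  chart_mapK : forall p, chart_dom p -> chart_inv (chart_map p) = p;
  chart_map_cont : forall p, chart_dom p -> {for p, continuous chart_map};
  chart_inv_cont : forall x, (chart_map @` chart_dom) x ->
    {for x, continuous chart_inv} }.

Definition chart_image (c : chart) : set 'rV[R]_n :=
  chart_map c @` chart_dom c.

Definition overlap (c c' : chart) : set 'rV[R]_n :=
  chart_map c @` (chart_dom c `&` chart_dom c').

Definition transition (c c' : chart) : 'rV[R]_n -> 'rV[R]_n :=
  chart_map c' \o chart_inv c.

Record manifold := Manifold {
  atlas : set chart;
  manifold_hausdorff : hausdorff_space E;
  manifold_countable : @second_countable E;
  atlas_cover : forall p, exists2 c, atlas c & chart_dom c p;
  atlas_smooth : forall c c', atlas c -> atlas c' ->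
    smooth_on (overlap c c') (transition c c') }.

(* The tangent bundle of E is covered by the charts (x, xdot) induced by the
   charts of E. In such a chart its points, and also its tangent vectors, are
   pairs of row vectors. *)
Definition TV : normedModType R := ('rV[R]_n * 'rV[R]_n)%type.

Definition T_image (c : chart) : set TV := [set z | chart_image c z.1].

Definition T_overlap (c c' : chart) : set TV := [set z | overlap c c' z.1].

Definition T_transition (c c' : chart) (z : TV) : TV :=
  (transition c c' z.1, 'd (transition c c') (z.1) z.2).

(* An r-form (2-vector) on TE is given by its expressions in the induced
   charts. *)
Definition Tform (r : nat) := chart -> form TV r.
Definition Tbivector := chart -> bivector TV.

Definition T_vanishes (M : manifold) r (phi : Tform r) :=
  forall c, atlas M c -> forall z, T_image c z -> forall A, phi c z A = 0.

Definition T_closed (M : manifold) r (phi : Tform r) :=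
  T_vanishes M (fun c => extd (phi c)).

Definition T_nondegenerate (M : manifold) (om : Tform 2) :=
  forall c, atlas M c -> forall z, T_image c z -> forall A : TV,
    (forall B : TV, om c z (fun k => if k == ord0 then A else B) = 0) -> A = 0.

Definition T_symplectic (M : manifold) (om : Tform 2) :=
  T_closed M om /\ T_nondegenerate M om.

Definition T_poisson (M : manifold) (P : Tbivector) :=
  forall c, atlas M c -> forall z, T_image c z -> forall a b e : {scalar TV},
    schouten (P c) (P c) z a b e = 0.

Definition pd (l : 'I_n) : TV := (delta_mx 0 l, 0).
Definition pdot (l : 'I_n) : TV := (0, delta_mx 0 l).
Definition dx (l : 'I_n) (A : TV) : R := A.1 0 l.
Definition ddot (l : 'I_n) (A : TV) : R := A.2 0 l.

Definition liouville (z : TV) : TV := \sum_l z.2 0 l *: pdot l.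

(* K z l m is the component K_l^m at z *)
Definition hlift (K : TV -> 'M[R]_n) (z : TV) (l : 'I_n) : TV :=
  pd l + \sum_m K z l m *: pdot m.

(* d^l (x) (partial_l + K_l^m pdot_m), as a tangent-valued 1-form *)
Definition hproj (K : TV -> 'M[R]_n) (z : TV) (A : TV) : TV :=
  \sum_l dx l A *: hlift K z l.

(* The transformation law says that the projectors hproj (conn c) are the
   expressions of one tangent-valued 1-form on TE. *)
Record connection (M : manifold) := Connection {
  conn :> chart -> TV -> 'M[R]_n;
  conn_smooth : forall c, atlas M c -> smooth_on (T_image c) (conn c);
  conn_compat : forall c c', atlas M c -> atlas M c' ->
    forall z, T_overlap c c' z ->
    forall A : TV,
      'd (T_transition c c') z (hproj (conn c) z A) =
      hproj (conn c') (T_transition c c' z) ('d (T_transition c c') z A) }.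

Definition bilin (G : 'M[R]_n) (u v : 'rV[R]_n) : R := (u *m G *m v^T) 0 0.

Definition flat (g : chart -> 'rV[R]_n -> 'M[R]_n) : Tform 1 := fun c z A =>
  \sum_l \sum_m g c z.1 l m * z.2 0 l * dx m (A ord0).

Definition Upsilon (g : chart -> 'rV[R]_n -> 'M[R]_n)
    (K : chart -> TV -> 'M[R]_n) : Tform 2 := fun c z A =>
  \sum_l \sum_m g c z.1 l m *
    wedge (fun B => ddot l B - \sum_k K c z k l * dx k B) (dx m) A.

Definition Lambda (g : chart -> 'rV[R]_n -> 'M[R]_n)
    (K : chart -> TV -> 'M[R]_n) : Tbivector := fun c z a =>
  \sum_l \sum_m invmx (g c z.1) l m *: vwedge (hlift (K c) z l) (pdot m) a.

Definition lie_liouville r (phi : Tform r.+1) : Tform r.+1 :=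
  fun c => lie_vec liouville (phi c).

Definition lie_conn (K : chart -> TV -> 'M[R]_n) r (phi : Tform r)
    : Tform r.+1 :=
  fun c => lie_tv (hproj (K c)) (phi c).

(* an orientation is a continuous choice of sign for each chart *)
Record orientation (M : manifold) := Orientation {
  osign :> chart -> 'rV[R]_n -> R;
  osign_val : forall c, atlas M c -> forall x, chart_image c x ->
    osign c x = 1 \/ osign c x = -1;
  osign_cont : forall c, atlas M c -> forall x, chart_image c x ->
    {for x, continuous (osign c)};
  osign_compat : forall c c', atlas M c -> atlas M c' ->
    forall x, overlap c c' x ->
    osign c' (transition c c' x) =
    Num.sg (\det (jacobian (transition c c') x)) * osign c x }.

End Manifold.

Arguments chart {R} n E.
Arguments manifold {R} n E.

Section Spacetime.
Context {R : realType} (E : topologicalType).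

Definition minkowski : 'M[R]_4 :=
  diag_mx (\row_i (if i == ord0 then -1 else 1)).

(* components in terms of a fixed unit of length *)
Record lorentz_metric (M : manifold (R := R) 4 E) := LorentzMetric {
  met :> chart (R := R) 4 E -> 'rV[R]_4 -> 'M[R]_4;
  met_smooth : forall c, atlas M c -> smooth_on (chart_image c) (met c);
  met_sym : forall c, atlas M c -> forall x, chart_image c x ->
    (met c x)^T = met c x;
  met_lorentz : forall c, atlas M c -> forall x, chart_image c x ->
    exists2 P, P \in unitmx & P *m met c x *m P^T = minkowski;
  met_compat : forall c c', atlas M c -> atlas M c' ->
    forall x, overlap c c' x ->
    forall u v,
      bilin (met c' (transition c c' x))
        ('d (transition c c') x u) ('d (transition c c') x v) =
      bilin (met c x) u v }.

Definition timelike (G : 'M[R]_4) (v : 'rV[R]_4) := bilin G v v < 0.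

(* a time orientation is a smooth choice of one of the two timecones at each
   point *)
Record time_orientation (M : manifold (R := R) 4 E) (g : lorentz_metric M) :=
  TimeOrientation {
  timecone :> chart (R := R) 4 E -> 'rV[R]_4 -> set 'rV[R]_4;
  timeconeE : forall c, atlas M c -> forall x, chart_image c x ->
    exists2 u, timelike (g c x) u &
      timecone c x = [set v | timelike (g c x) v /\ bilin (g c x) u v < 0];
  timecone_smooth : forall c, atlas M c -> forall x, chart_image c x ->
    exists U X, [/\ open U, U x, U `<=` chart_image c,
      smooth_on U (X : 'rV[R]_4 -> 'rV[R]_4) &
      forall y, U y -> timecone c y (X y)];
  timecone_compat : forall c c', atlas M c -> atlas M c' ->
    forall x, overlap c c' x ->
    forall v, timecone c' (transition c c' x) ('d (transition c c') x v) <->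
      timecone c x v }.

Record spacetime := Spacetime {
  st_manifold :> manifold (R := R) 4 E;
  st_metric : lorentz_metric st_manifold;
  st_orientation : orientation st_manifold;
  st_time_orientation : time_orientation st_metric }.

End Spacetime.

Arguments spacetime R E : clear implicits.

(* Main.v *)
Require Import Defs.
From mathcomp Require Import all_boot all_order all_algebra.
From mathcomp Require Import all_classical all_reals all_analysis.
From HB Require Import structures.
From mathcomp Require Import ring.

Import Defs.
Set Implicit Arguments.
Unset Strict Implicit.
Unset Printing Implicit Defensive.
Import Order.TTheory GRing.Theory Num.Theory.
Import numFieldNormedType.Exports.
Local Open Scope classical_set_scope.
Local Open Scope ring_scope.

(** Everything is local, so fix an induced chart of the tangent bundle, with
    points z = (x, y), and write theta for the 1-form given by g, so that
    theta_z(A) = g_x(y, A.1), and N for the horizontal projector of K.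

    The form om := L[K] theta is horizontal: it depends only on the base
    components of its arguments, since N does not change base components and
    the terms of d theta that involve the vertical component A.2 get replaced
    by terms in A.1 K ([lie_conn_flatE]). The same computation gives
    Upsilon = d theta - L[K] theta ([Upsilon_eq]). As d d = 0, which is the
    symmetry of second derivatives ([derive_comm]), Upsilon is closed exactly
    when om is.

    For a horizontal 2-form om, both Lie derivatives are governed by d om
    ([horizontal_closedP]). The Liouville field I is vertical, so L[I] om is
    the derivative of om along I. If it vanishes, the components of om are
    homogeneous of degree 0 on each tangent space; being differentiable at
    the zero section too, they are constant there ([euler_fibre]). Then d om
    is also horizontal, hence i(K) d om = 3 d om, while i(K) om = 2 om, and
    L[K] om = 3 d om - 2 d om = d om. So the two conditions together say that
    om is closed, that is, that Upsilon is closed.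

    The other two properties then come for free. Upsilon is always
    nondegenerate because g is ([Upsilon_nondegenerate]). Contraction with
    Lambda inverts contraction with Upsilon ([Upsilon_Lambda]), and for such
    a pair the Schouten bracket [Lambda, Lambda] on three covectors is twice
    d Upsilon on the corresponding vectors ([schouten_inverse]); hence Lambda
    is Poisson as soon as Upsilon is closed. *)

(** * Symmetry of second derivatives *)

Section Smooth.
Context {R : realType}.

Lemma near_eq_differentiable {V W : normedModType R} (f g : V -> W) (x : V) :
  {near x, f =1 g} -> differentiable f x -> differentiable g x.
Proof.
move=> fg /diff_locallyP[dfc df].
have dg : g \o shift x = cst (g x) + 'd f x +o_ 0 id.
  apply/eqaddoP => _/posnumP[e]; move/eqaddoP: df => /(_ e%:num (gt0 _)).
  have : \forall h \near (0 : V), f (h + x) = g (h + x).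
    have /(_ _ fg) : (fun h : V => h + x) @ (0 : V) --> x.
      by rewrite -[in X in _ --> X](add0r x); apply: cvgD; [exact: cvg_id|exact: cvg_cst].
    by [].
  by apply: filterS2 => h; rewrite /= fctE /= => ->; rewrite (nbhs_singleton fg).
by apply/diff_locallyP; rewrite (diff_unique dfc dg).
Qed.

Lemma is_derive_line {V W : normedModType R} (f : V -> W) (x v : V) (s : R) :
  derivable f (s *: v + x) v ->
  is_derive s 1 (fun t : R => f (t *: v + x)) ('D_v f (s *: v + x)).
Proof.
move=> df; suff E : (fun h : R => h^-1 *: (((fun t : R => f (t *: v + x)) \o shift s)
    (h *: (1 : R)) - f (s *: v + x))) =
    (fun h => h^-1 *: ((f \o shift (s *: v + x)) (h *: v) - f (s *: v + x))).
  by split; rewrite /derivable /derive E.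
by apply/funext => h /=; rewrite [h%:A]mulr1 scalerDl addrA.
Qed.

Lemma is_derive_translate {V W : normedModType R} (f : V -> W) (x a v : V) :
  derivable f (a + x) v ->
  is_derive x v (fun y => f (y + a)) ('D_v f (a + x)).
Proof.
move=> df; have E : (fun k : R => k^-1 *: (((fun y => f (y + a)) \o shift x) (k *: v)
      - f (x + a))) =
    (fun k => k^-1 *: ((f \o shift (a + x)) (k *: v) - f (a + x))).
  by apply/funext => k /=; rewrite -addrA [x + a]addrC.
split; first by rewrite /derivable E; exact: df.
by rewrite /derive E.
Qed.

Lemma mean_value_line {V : normedModType R} (f : V -> R) (x v : V) (d : R) :
  0 < d -> (forall s, s \in `[0, d] -> derivable f (s *: v + x) v) ->
  exists2 s, s \in `]0, d[ & f (d *: v + x) - f x = d * 'D_v f (s *: v + x).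
Proof.
move=> d0 df.
have [] := @MVT R (fun t => f (t *: v + x))
    (fun t => 'D_v f (t *: v + x)) 0 d d0.
- move=> t td; apply: is_derive_line; apply: df.
  by apply: subset_itv_oo_cc td.
- apply: derivable_within_continuous => t td.
  by have [] := is_derive_line (df t td).
- by move=> s sd; rewrite scale0r add0r subr0 mulrC => ->; exists s.
Qed.

(** The mean value theorem, applied in the direction u and then in the
    direction v. The left-hand side is symmetric in u and v, the right-hand
    side is not. *)
Lemma second_difference {V : normedModType R} (f : V -> R) (x u v : V) (d : R) :
  0 < d ->
  (forall s t, s \in `[0, d] -> t \in `[0, d] ->
     derivable f (s *: u + t *: v + x) u) ->
  (forall s t, s \in `[0, d] -> t \in `[0, d] ->
     derivable ('D_u f) (s *: u + t *: v + x) v) ->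
  exists s t, [/\ s \in `[0, d], t \in `[0, d] &
    f (d *: u + d *: v + x) - f (d *: u + x) - f (d *: v + x) + f x =
    d ^+ 2 * 'D_v ('D_u f) (s *: u + t *: v + x)].
Proof.
move=> d0 df ddf.
have Id : d \in `[0, d] by rewrite in_itv /= lexx ltW.
have I0 : 0 \in `[0, d] by rewrite in_itv /= lexx ltW.
pose h (y : V) := f (y + d *: v) - f y.
have dh s : s \in `[0, d] ->
    is_derive (s *: u + x) u h
      ('D_u f (d *: v + (s *: u + x)) - 'D_u f (s *: u + x)).
  move=> sd; have d1 : derivable f (s *: u + x) u.
    by have := df s 0 sd I0; rewrite scale0r addr0.
  have d2 : derivable f (d *: v + (s *: u + x)) u.
    by have := df s d sd Id; rewrite addrAC addrC.
  exact: is_deriveB (is_derive_translate d2) (derivableP d1).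
have dh' s : s \in `[0, d] -> derivable h (s *: u + x) u.
  by move=> sd; have [] := dh s sd.
have [s /subset_itv_oo_cc sd Eu] := @mean_value_line V h x u d d0 dh'.
have [_ hE] := dh s sd; rewrite {}hE in Eu.
have ddf' t : t \in `[0, d] -> derivable ('D_u f) (t *: v + (s *: u + x)) v.
  by move=> td; rewrite addrCA addrA; exact: ddf.
have [t /subset_itv_oo_cc td Ev] := @mean_value_line V ('D_u f) (s *: u + x) v d d0 ddf'.
have Ep : t *: v + (s *: u + x) = s *: u + t *: v + x by rewrite addrCA addrA.
have Ed : d *: u + d *: v + x = d *: u + x + d *: v by rewrite addrAC.
have Ev' : d *: v + x = x + d *: v by rewrite addrC.
exists s, t; split; [exact: sd|exact: td|].
rewrite -Ep expr2 -mulrA -Ev -Eu Ed Ev' /h.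
by move: (f _) (f _) (f _) (f _) => p q r o; rewrite opprB addrA addrAC.
Qed.

(** Both mixed derivatives at x are limits of the same second difference
    quotient, and both are continuous at x. *)
Lemma derive_comm {V : normedModType R} (U : set V) (f : V -> R) (x u v : V) :
  open U -> U x -> smooth_on U f -> 'D_u ('D_v f) x = 'D_v ('D_u f) x.
Proof.
move=> oU Ux sf.
have cF a b : {for x, continuous ('D_a ('D_b f))}.
  by apply: differentiable_continuous; exact: (sf [:: a; b]).
apply/eqP; rewrite -subr_eq0 -normr_le0; apply/ler_addgt0Pl => e e0.
rewrite addr0.
pose A := [set y | [/\ U y, `|'D_u ('D_v f) x - 'D_u ('D_v f) y| < e / 2 &
   `|'D_v ('D_u f) x - 'D_v ('D_u f) y| < e / 2]].
have nA : nbhs x A.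
  have e2 : 0 < e / 2 by rewrite divr_gt0.
  have h1 : \forall y \near x, `|'D_u ('D_v f) x - 'D_u ('D_v f) y| < e / 2.
    by move/cvgrPdist_lt: (cF u v) => /(_ _ e2).
  have h2 : \forall y \near x, `|'D_v ('D_u f) x - 'D_v ('D_u f) y| < e / 2.
    by move/cvgrPdist_lt: (cF v u) => /(_ _ e2).
  have h3 := open_nbhs_nbhs (conj oU Ux).
  have fx : Filter (nbhs x) by exact: nbhs_filter.
  by apply: filterS (filterI h3 (filterI h1 h2)) => y [? [? ?]].
have [d d0 dA] : exists2 d, 0 < d & forall s t, s \in `[0, d] -> t \in `[0, d] ->
    A (s *: u + t *: v + x).
  move/nbhs_normP: nA => [r /= r0 rA]; pose m := `|u| + `|v| + 1.
  have m0 : 0 < m by rewrite /m ltr_wpDl // addr_ge0.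
  (* The parallelogram spanned by d u and d v has to stay within r of x. *)
  exists (r / m / 2); first by rewrite !divr_gt0.
  move=> s t; rewrite !in_itv /= => /andP[s0 sd] /andP[t0 td]; apply: rA => /=.
  rewrite opprD addrCA subrr addr0 normrN (le_lt_trans (ler_normD _ _)) //.
  rewrite !normrZ !ger0_norm //.
  rewrite (@le_lt_trans _ _ (r / m / 2 * (`|u| + `|v|))) //.
    by rewrite mulrDr lerD // ler_wpM2r.
  rewrite (@lt_trans _ _ (r / m / 2 * m)) //.
    by rewrite ltr_pM2l ?divr_gt0 // /m ltrDl.
  by rewrite mulrAC divfK ?gt_eqF // ltr_pdivrMr // ltr_pMr // ltr1n.
have [||s1 [t1 [s1d t1d E1]]] := @second_difference V f x u v d d0.
- by move=> s t sd td; apply/diff_derivable; apply: (sf [::]); have [] := dA s t sd td.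
- by move=> s t sd td; apply/diff_derivable; apply: (sf [:: u]); have [] := dA s t sd td.
have [||s2 [t2 [s2d t2d E2]]] := @second_difference V f x v u d d0.
- move=> s t sd td; apply/diff_derivable; apply: (sf [::]); have [] := dA t s td sd.
  by rewrite [t *: u + _]addrC.
- move=> s t sd td; apply/diff_derivable; apply: (sf [:: v]); have [] := dA t s td sd.
  by rewrite [t *: u + _]addrC.
have Et : s2 *: v + t2 *: u + x = t2 *: u + s2 *: v + x by rewrite [s2 *: v + _]addrC.
have Ed : d *: v + d *: u + x = d *: u + d *: v + x by rewrite [d *: v + _]addrC.
rewrite Et Ed in E2.
have E : 'D_v ('D_u f) (s1 *: u + t1 *: v + x) = 'D_u ('D_v f) (t2 *: u + s2 *: v + x).
  have d20 : d ^+ 2 != 0 by rewrite expf_neq0 // gt_eqF.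
  apply: (mulfI d20); apply: etrans (esym E1) _; apply: etrans E2.
  by congr (_ + _); exact: addrAC.
have [_ _ H1] := dA _ _ s1d t1d; have [_ H2 _] := dA _ _ t2d s2d.
rewrite {}E in H1; move: H1 H2.
set p := 'D_u ('D_v f) x; set q := 'D_v ('D_u f) x; set r := 'D_u _ _.
clearbody p q r => qr pr; rewrite distrC in qr.
by rewrite ltW // (le_lt_trans (ler_distD r _ _)) // (splitr e) ltrD.
Qed.

End Smooth.

(** * Smooth functions *)

Section SmoothAlgebra.
Context {R : realType}.

Lemma smooth_on_diff {V W : normedModType R} (U : set V) (f : V -> W) x :
  smooth_on U f -> U x -> differentiable f x.
Proof. by move=> sf Ux; exact: (sf [::]). Qed.

Lemma smooth_on_derive {V W : normedModType R} (U : set V) (f : V -> W) v :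
  smooth_on U f -> smooth_on U ('D_v f).
Proof.
move=> sf s x Ux; have := sf (rcons s v) x Ux.
by rewrite -cats1 foldr_cat.
Qed.

(** Smoothness bounds all iterated derivatives at once, so it is proved by
    exhibiting a class of differentiable functions that is stable under a
    single directional derivative. *)
Lemma smooth_on_coind {V W : normedModType R} (U : set V)
    (P : (V -> W) -> Prop) (f : V -> W) :
  open U ->
  (forall g x, P g -> U x -> differentiable g x) ->
  (forall g v, P g -> exists2 h, P h & forall x, U x -> 'D_v g x = h x) ->
  P f -> smooth_on U f.
Proof.
move=> oU Pdiff Pder Pf s.
suff [g Pg fg] : exists2 g, P g &
    forall x, U x -> foldr (fun v h => 'D_v h) f s x = g x.
  move=> x Ux; apply: near_eq_differentiable (Pdiff g x Pg Ux).
  by apply: filterS (open_nbhs_nbhs (conj oU Ux)) => y Uy; exact/esym/fg.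
elim: s => [|v s [g Pg fg]]; first by exists f.
have [h Ph gh] := Pder g v Pg; exists h => // x Ux; rewrite -gh //=.
apply: near_eq_derive.
by apply: filterS (open_nbhs_nbhs (conj oU Ux)) => y; exact: fg.
Qed.

Lemma smooth_on_affine {V W : normedModType R} (U : set V)
    (l : {linear V -> W}) (c : W) :
  open U -> continuous l -> smooth_on U (fun x => c + l x).
Proof.
move=> oU lc.
pose P (f : V -> W) := exists (c : W) (k : {linear V -> W}),
  continuous k /\ f = (fun x => c + k x).
apply: (@smooth_on_coind _ _ U P) => //; last by exists c, l.
- move=> _ x [d [k [kc ->]]] _; apply: differentiableD => //.
  exact: linear_differentiable.
- move=> _ v [d [k [kc ->]]]; exists (fun=> k v) => [|x Ux]; last first.
    rewrite (@deriveD _ _ _ (cst d) k) ?derive_cst ?add0r //.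
      have kd : differentiable k x by exact: linear_differentiable.
      by rewrite deriveE // diff_lin.
    by apply: diff_derivable; exact: linear_differentiable.
  exists (k v), \0; split; first exact: cst_continuous.
  by apply/funext => x; rewrite addr0.
Qed.

Lemma smooth_on_cst {V W : normedModType R} (U : set V) (c : W) :
  open U -> smooth_on U (fun=> c).
Proof.
move=> oU; have -> : (fun=> c) = (fun x => c + (\0 : {linear V -> W}) x).
  by apply/funext => x; rewrite addr0.
by apply: smooth_on_affine => //; exact: cst_continuous.
Qed.

(** The derivative of a product is a sum of products, so sums and products
    have to be closed simultaneously for [smooth_on_coind] to apply. *)
Inductive smooth_closure {V : normedModType R} (U : set V) : (V -> R) -> Prop :=
| SCbase f : smooth_on U f -> smooth_closure U f
| SCadd f g : smooth_closure U f -> smooth_closure U g ->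
    smooth_closure U (f + g)
| SCmul f g : smooth_closure U f -> smooth_closure U g ->
    smooth_closure U (f * g).

Lemma smooth_closure_smooth {V : normedModType R} (U : set V) (f : V -> R) :
  open U -> smooth_closure U f -> smooth_on U f.
Proof.
move=> oU; have cd (g : V -> R) x : smooth_closure U g -> U x -> differentiable g x.
  move=> cg Ux; elim: cg => {g} [g sg|g h _ dg _ dh|g h _ dg _ dh].
  - exact: smooth_on_diff sg Ux.
  - exact: differentiableD.
  - exact: differentiableM.
apply: smooth_on_coind => // g v; elim=> {g} [g sg|g h cg [g' cg' gg'] ch [h' ch' hh']|
    g h cg [g' cg' gg'] ch [h' ch' hh']].
- by exists ('D_v g) => //; apply/SCbase/smooth_on_derive.
- exists (g' + h') => [|x Ux]; first exact: SCadd.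
  by rewrite deriveD ?gg' ?hh' //; apply/diff_derivable/cd.
- exists (g * h' + h * g') => [|x Ux]; first by apply: SCadd; apply: SCmul.
  by rewrite deriveM ?gg' ?hh' //; apply/diff_derivable/cd.
Qed.

Lemma smooth_onM {V : normedModType R} (U : set V) (f g : V -> R) : open U ->
  smooth_on U f -> smooth_on U g -> smooth_on U (fun x => f x * g x).
Proof.
move=> oU sf sg; apply: smooth_closure_smooth => //.
by apply: (@SCmul _ U f g); exact: SCbase.
Qed.

Lemma smooth_onD {V : normedModType R} (U : set V) (f g : V -> R) : open U ->
  smooth_on U f -> smooth_on U g -> smooth_on U (fun x => f x + g x).
Proof.
move=> oU sf sg; apply: smooth_closure_smooth => //.
by apply: (@SCadd _ U f g); exact: SCbase.
Qed.

Lemma smooth_onB {V : normedModType R} (U : set V) (f g : V -> R) : open U ->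
  smooth_on U f -> smooth_on U g -> smooth_on U (fun x => f x - g x).
Proof.
move=> oU sf sg; apply: smooth_onD => //.
under eq_fun do rewrite -mulN1r.
by apply: smooth_onM => //; exact: smooth_on_cst.
Qed.

Lemma smooth_on_sum {V : normedModType R} (U : set V) (I : Type) (r : seq I)
    (f : I -> V -> R) : open U -> (forall i, smooth_on U (f i)) ->
  smooth_on U (fun x => \sum_(i <- r) f i x).
Proof.
move=> oU sf; have -> : (fun x => \sum_(i <- r) f i x) = \sum_(i <- r) f i.
  by apply/funext => x; rewrite fct_sumE.
elim/big_ind: _ => // [|g h sg sh]; first exact: smooth_on_cst.
exact: (smooth_onD oU sg sh).
Qed.

Lemma smooth_on_entry {V : normedModType R} (U : set V) m n
    (M : V -> 'M[R]_(m, n)) i j : open U ->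
  smooth_on U M -> smooth_on U (fun x => M x i j).
Proof.
move=> oU sM.
pose P (f : V -> R) := exists2 N : V -> 'M[R]_(m, n), smooth_on U N &
  f = (fun x => N x i j).
apply: (@smooth_on_coind _ _ U P) => //; last by exists M.
- move=> _ x [N sN ->] Ux.
  apply: (@differentiable_comp _ _ _ _ N (fun A : 'M[R]_(m, n) => A i j)).
    exact: smooth_on_diff sN Ux.
  exact: differentiable_coord.
- move=> _ v [N sN ->]; exists (fun x => 'D_v N x i j) => [|x Ux].
    by exists ('D_v N) => //; exact: smooth_on_derive.
  by rewrite derive_mx ?mxE //; apply/diff_derivable; exact: smooth_on_diff sN Ux.
Qed.

Lemma differentiable_fst {V W : normedModType R} (z : V * W) :
  differentiable (fst : V * W -> V) z.
Proof.
have H := @linear_differentiable R (V * W)%type V (fst : {linear (V * W)%type -> V}) z.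
by apply: H => p; exact: cvg_fst.
Qed.

Lemma smooth_on_fst {V W X : normedModType R} (U : set V) (f : V -> X) :
  open U -> smooth_on U f ->
  smooth_on [set z : V * W | U z.1] (fun z => f z.1).
Proof.
move=> oU sf.
pose P (h : V * W -> X) := exists2 f : V -> X, smooth_on U f &
  h = (fun z => f z.1).
apply: (@smooth_on_coind _ _ _ P) => //; last by exists f.
- by apply: open_comp => // p _; exact: cvg_fst.
- move=> _ z [g sg ->] Uz.
  apply: (@differentiable_comp _ _ _ _ (fst : V * W -> V) g) => //.
  exact: differentiable_fst.
  exact: smooth_on_diff sg Uz.
- move=> _ v [g sg ->]; exists (fun z => 'D_(v.1) g z.1) => [|z Uz].
    by exists ('D_(v.1) g) => //; exact: smooth_on_derive.
  by [].
Qed.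
End SmoothAlgebra.

(** * Exterior derivatives and contractions in low degree *)

Section Forms.
Context {R : realType} {V : normedModType R}.
Implicit Types (z a b c : V) (U : set V).

Definition pairv (a b : V) : 'I_2 -> V := fun k => if k == ord0 then a else b.

Definition triple (a b c : V) : 'I_3 -> V := fun k =>
  if k == ord0 then a else if k == ord_max then c else b.

Lemma form1_eta (A : 'I_1 -> V) : A = fun=> A ord0.
Proof. by apply/funext => k; rewrite ord1. Qed.

Lemma pairv_eta (A : 'I_2 -> V) : A = pairv (A ord0) (A ord_max).
Proof.
apply/funext => k; rewrite /pairv; case: ifPn => [/eqP -> //|k0].
by congr A; apply/val_inj; case: k k0 => -[|[|]].
Qed.

Lemma triple_eta (A : 'I_3 -> V) : exists a b c, A = triple a b c.
Proof.
exists (A ord0), (A (lift ord0 ord0)), (A ord_max); apply/funext => k.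
rewrite /triple; case: ifPn => [/eqP -> //|k0]; case: ifPn => [/eqP -> //|k2].
by congr A; apply/val_inj; case: k k0 k2 => -[|[|[|]]].
Qed.

Lemma extd1E (phi : form V 1) z a b :
  extd phi z (pairv a b) =
  'D_a (fun y => phi y (fun=> b)) z - 'D_b (fun y => phi y (fun=> a)) z.
Proof.
have e0 : (fun j => pairv a b (lift ord0 j)) = fun=> b.
  by apply/funext => j.
have e1 : (fun j => pairv a b (lift (lift ord0 ord0) j)) = fun=> a.
  by apply/funext; case=> -[|].
by rewrite /extd !big_ord_recl big_ord0 e0 e1 addr0 expr0 mul1r expr1 mulN1r.
Qed.

Lemma extd2E (phi : form V 2) z a b c :
  extd phi z (triple a b c) =
  'D_a (fun y => phi y (pairv b c)) z - 'D_b (fun y => phi y (pairv a c)) z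
  + 'D_c (fun y => phi y (pairv a b)) z.
Proof.
have e0 : (fun j => triple a b c (lift ord0 j)) = pairv b c.
  by apply/funext; case=> -[|[|]].
have e1 : (fun j => triple a b c (lift (lift ord0 ord0) j)) = pairv a c.
  by apply/funext; case=> -[|[|]].
have e2 : (fun j => triple a b c (lift (lift ord0 (lift ord0 ord0)) j)) = pairv a b.
  by apply/funext; case=> -[|[|]].
rewrite /extd !big_ord_recl big_ord0 e0 e1 e2 addr0 expr0 mul1r expr1 mulN1r.
by rewrite sqrrN expr1n mul1r addrA.
Qed.

Lemma near_eq_extd r (phi psi : form V r) U z A : open U -> U z ->
  (forall y B, U y -> phi y B = psi y B) -> extd phi z A = extd psi z A.
Proof.
move=> oU Uz e; apply: eq_bigr => i _; congr (_ * _); apply: near_eq_derive.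
by apply: filterS (open_nbhs_nbhs (conj oU Uz)) => y; exact: e.
Qed.

Lemma extdB r (phi psi : form V r) z A :
  (forall B, differentiable (phi^~ B) z) ->
  (forall B, differentiable (psi^~ B) z) ->
  extd (fun y B => phi y B - psi y B) z A = extd phi z A - extd psi z A.
Proof.
move=> dphi dpsi; rewrite /extd -sumrB; apply: eq_bigr => i _.
by rewrite -mulrBr deriveB //; exact: diff_derivable.
Qed.

Lemma extdMn r (phi : form V r) n z A :
  (forall B, differentiable (phi^~ B) z) ->
  extd (fun y B => phi y B *+ n) z A = extd phi z A *+ n.
Proof.
move=> dphi; rewrite /extd -sumrMnl; apply: eq_bigr => i _.
rewrite -mulrnAr; congr (_ * _).
have -> : (fun y => phi y (fun j => A (lift i j)) *+ n) =
    n%:R *: (fun y => phi y (fun j => A (lift i j))).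
  by apply/funext => y; rewrite fctE /= -[RHS]/(_ * _) mulr_natl.
by rewrite deriveZ /= ?scaler_nat //; exact: diff_derivable.
Qed.

(** The second derivatives cancel in pairs by [derive_comm]. *)
Lemma extd_extd1 (phi : form V 1) U z A : open U -> U z ->
  (forall a, smooth_on U (fun y => phi y (fun=> a))) ->
  extd (extd phi) z A = 0.
Proof.
move=> oU Uz sphi; have [a [b [c ->]]] := triple_eta A.
pose f a y := phi y (fun=> a).
have sf a' b' : differentiable ('D_a' (f b')) z.
  exact: smooth_on_diff (smooth_on_derive _ (sphi _)) Uz.
have E u v w : 'D_u (fun y => extd phi y (pairv v w)) z =
    'D_u ('D_v (f w)) z - 'D_u ('D_w (f v)) z.
  have -> : (fun y => extd phi y (pairv v w)) = 'D_v (f w) - 'D_w (f v).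
    by apply/funext => y; rewrite extd1E.
  by rewrite deriveB //; exact: diff_derivable.
have := derive_comm a b oU Uz (sphi c).
have := derive_comm a c oU Uz (sphi b).
have := derive_comm b c oU Uz (sphi a).
rewrite extd2E !E -/(f a) -/(f b) -/(f c).
set p := 'D_b ('D_c _) z; set q := 'D_a ('D_c _) z; set r := 'D_a ('D_b _) z.
set p' := 'D_c ('D_b _) z; set q' := 'D_c ('D_a _) z; set r' := 'D_b ('D_a _) z.
by clearbody p q r p' q' r' => -> -> ->; ring.
Qed.

Lemma iota_tv2E (N : V -> V -> V) (phi : form V 2) z a b :
  iota_tv N phi z (pairv a b) = phi z (pairv (N z a) b) + phi z (pairv a (N z b)).
Proof.
rewrite /iota_tv !big_ord_recl big_ord0 addr0.
by congr (_ + _); congr phi; apply/funext; case=> -[|[|]].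
Qed.

Lemma iota_vec2E (X : V -> V) (phi : form V 2) z a :
  iota_vec X phi z (fun=> a) = phi z (pairv (X z) a).
Proof.
rewrite /iota_vec; congr phi; apply/funext => k; rewrite /pairv.
case: unliftP => [j ->|->]; last by rewrite eqxx.
by rewrite eq_sym (negbTE (neq_lift _ _)).
Qed.

Lemma iota_vec3E (X : V -> V) (phi : form V 3) z a b :
  iota_vec X phi z (pairv a b) = phi z (triple (X z) a b).
Proof.
rewrite /iota_vec; congr phi; apply/funext => k; rewrite /triple.
case: unliftP => [j ->|->]; last by rewrite eqxx.
by rewrite eq_sym (negbTE (neq_lift _ _)); case: j => -[|[|]].
Qed.

End Forms.

(** * Horizontal forms on a product *)

Lemma fst_sum (V W : zmodType) (I : Type) (r : seq I) (F : I -> V * W) :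
  (\sum_(i <- r) F i).1 = \sum_(i <- r) (F i).1.
Proof. exact: (big_morph fst). Qed.

Lemma snd_sum (V W : zmodType) (I : Type) (r : seq I) (F : I -> V * W) :
  (\sum_(i <- r) F i).2 = \sum_(i <- r) (F i).2.
Proof. exact: (big_morph snd). Qed.

Lemma pair_ext (V W : Type) (a b : V * W) : a.1 = b.1 -> a.2 = b.2 -> a = b.
Proof. by case: a b => ? ? [? ?] /= -> ->. Qed.

Section Horizontal.
Context {R : realType} {V W : normedModType R}.
Local Notation T := (V * W)%type.

(** A homogeneous function of degree 0 is constant on rays; its value at the
    origin is then forced by continuity. The mean value theorem gives a point
    of the open segment from (x, 0) to (x, y), where the derivative along y
    is a multiple of the derivative along the position vector. *)
Lemma euler_fibre (f : T -> R) (x : V) (y : W) :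
  (forall y', differentiable f (x, y')) ->
  (forall y', 'D_((0, y') : T) f (x, y') = 0) ->
  f (x, y) = f (x, 0).
Proof.
move=> df Df.
have lineE (t : R) : t *: ((0, y) : T) + (x, 0) = (x, t *: y) :> T.
  by apply/pair_equal_spec; split => /=; rewrite ?scaler0 ?add0r ?addr0.
have dl (s : R) : s \in `[0, 1] ->
    derivable f (s *: ((0, y) : T) + (x, 0)) ((0, y) : T).
  by move=> _; rewrite lineE; exact: diff_derivable.
have [s s01] := mean_value_line ltr01 dl.
have s0 : s != 0 by move: s01; rewrite in_itv /= => /andP[/gt_eqF ->].
rewrite !lineE scale1r mul1r => /eqP; rewrite subr_eq => /eqP ->.
apply/eqP; rewrite -subr_eq0 addrK; apply/eqP; apply: (mulfI s0).
rewrite mulr0 -[RHS](Df (s *: y)) !deriveE //.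
have -> : (0, s *: y) = s *: (0, y) :> T.
  by apply/pair_equal_spec; split => /=; rewrite ?scaler0.
by rewrite linearZ.
Qed.

(** The difference u - v is vertical, and f is constant along the line through
    z in that direction. *)
Lemma derive_fibre (f : T -> R) (z u v : T) :
  differentiable f z -> (forall y, f (z.1, y) = f z) -> u.1 = v.1 ->
  'D_u f z = 'D_v f z.
Proof.
move=> df fc uv.
have D0 : 'D_(u - v) f z = 0.
  apply: lim_near_cst => //; near=> h => /=.
  have -> : h *: (u - v) + z = (z.1, h *: (u.2 - v.2) + z.2) :> T.
    by apply/pair_equal_spec; split => //=; rewrite uv subrr scaler0 add0r.
  by rewrite fc subrr scaler0.
by apply/eqP; rewrite -subr_eq0 -D0 !deriveE // linearB.
Unshelve. all: by end_near.
Qed.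

Definition horizontal r (phi : form T r) (z : T) :=
  forall A B, (forall k, (A k).1 = (B k).1) -> phi z A = phi z B.

(** Replacing one argument of phi by its image under N leaves phi unchanged,
    and the contraction is a sum of r such terms. *)
Lemma iota_tv_horizontal r (N : T -> T -> T) (phi : form T r) (z : T) A :
  (forall B, (N z B).1 = B.1) -> horizontal phi z ->
  iota_tv N phi z A = phi z A *+ r.
Proof.
move=> N1 hphi; rewrite /iota_tv (eq_bigr (fun=> phi z A)) => [|j _].
  by rewrite sumr_const card_ord.
by apply: hphi => k; case: eqP => // _; rewrite N1.
Qed.

Variables (U : set V) (oU : open U).
Let TU := [set z : T | U z.1].

Lemma open_fst_preimage : open TU.
Proof. by apply: open_comp => // p _; exact: cvg_fst. Qed.

(** The terms of the exterior derivative differentiate functions that are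
    constant along the fibre, so only base components matter. *)
Lemma extd_fibre r (phi : form T r) (z : T) :
  (forall y, TU y -> horizontal phi y) ->
  (forall A, differentiable (phi^~ A) z) ->
  (forall A y, phi (z.1, y) A = phi z A) -> TU z ->
  horizontal (extd phi) z.
Proof.
move=> hphi dphi cphi Uz A B AB; apply: eq_bigr => i _; congr (_ * _).
rewrite (@derive_fibre _ z _ (B i)) //.
apply: near_eq_derive.
apply: filterS (open_nbhs_nbhs (conj open_fst_preimage Uz)) => y Uy.
by apply: hphi => // j; exact: AB.
Qed.

Lemma lie_tv_horizontal r (N : T -> T -> T) (phi : form T r) z A :
  (forall y B, (N y B).1 = B.1) ->
  (forall y, TU y -> horizontal phi y) ->
  (forall B, differentiable (phi^~ B) z) -> TU z ->
  lie_tv N phi z A = iota_tv N (extd phi) z A - extd phi z A *+ r.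
Proof.
move=> N1 hphi dphi Uz; rewrite /lie_tv -extdMn //; congr (_ - _).
apply: near_eq_extd open_fst_preimage Uz _ => y B Uy.
by rewrite iota_tv_horizontal //; exact: hphi.
Qed.

Lemma lie_vec_vertical (X : T -> T) (phi : form T 2) z A :
  (forall y, (X y).1 = 0) ->
  (forall y v w, TU y -> v.1 = 0 -> phi y (pairv v w) = 0) -> TU z ->
  lie_vec X phi z A = iota_vec X (extd phi) z A.
Proof.
move=> X1 phi0 Uz; rewrite /lie_vec (@near_eq_extd _ _ _ _ (fun _ _ => 0) TU) //.
- by rewrite /extd big1 ?addr0 // => i _; rewrite derive_cst mulr0.
- exact: open_fst_preimage.
- by move=> y B Uy; rewrite [iota_vec _ _ _ _](_ : _ = phi y (pairv (X y) (B ord0)));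
    [exact: phi0|rewrite -iota_vec2E; congr iota_vec; apply/funext => k; rewrite ord1].
Qed.

(** The two terms of the exterior derivative in which X is an argument of phi
    vanish. *)
Lemma iota_vec_vertical (X : T -> T) (phi : form T 2) z a b :
  (forall y, (X y).1 = 0) ->
  (forall y v w, TU y -> v.1 = 0 -> phi y (pairv v w) = 0) ->
  (forall y, TU y -> horizontal phi y) -> TU z ->
  iota_vec X (extd phi) z (pairv a b) = 'D_(X z) (fun y => phi y (pairv a b)) z.
Proof.
move=> X1 phi0 hphi Uz.
have D0 u v : 'D_u (fun y => phi y (pairv (X z) v)) z = 0.
  rewrite -[RHS](derive_cst (0 : R) z u); apply: near_eq_derive.
  by apply: filterS (open_nbhs_nbhs (conj open_fst_preimage Uz)) => y Uy; exact: phi0.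
by rewrite iota_vec3E extd2E !D0 subr0 addr0.
Qed.

(** The Liouville condition makes phi constant along the fibres, after which
    the exterior derivative of phi is horizontal and equals its own Lie
    derivative along N, because 3 - 2 = 1. *)
Theorem horizontal_closedP (N : T -> T -> T) (X : T -> T) (phi : form T 2) :
  (forall y B, (N y B).1 = B.1) ->
  (forall y, X y = (0, y.2)) ->
  (forall y v w, TU y -> v.1 = 0 -> phi y (pairv v w) = 0) -> 
  (forall y, TU y -> horizontal phi y) ->
  (forall y A, TU y -> differentiable (phi^~ A) y) ->
  (forall y A, TU y -> extd phi y A = 0) <->
  (forall y A, TU y -> lie_vec X phi y A = 0) /\
  (forall y A, TU y -> lie_tv N phi y A = 0).
Proof.
move=> N1 XE phi0 hphi dphi.
have X1 y : (X y).1 = 0 by rewrite XE.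
have lX z A := @lie_vec_vertical X phi z A X1 phi0.
have lN z A (Uz : TU z) :=
  @lie_tv_horizontal _ N phi z A N1 hphi (fun B => dphi z B Uz) Uz.
split=> [cl|[LX LN]].
  split=> z A Uz; last first.
    rewrite lN // cl // mul0rn subr0 /iota_tv big1 // => j _; exact: cl.
  by rewrite lX // (pairv_eta A) iota_vec3E cl.
have fc z A : TU z -> forall y, phi (z.1, y) A = phi z A.
  move=> Uz y; have E y' : phi (z.1, y') A = phi (z.1, 0) A.
    apply: (@euler_fibre (phi^~ A)) => [w|w]; first exact: dphi.
    have := LX (z.1, w) A Uz; rewrite lX // (pairv_eta A) iota_vec_vertical //.
    by rewrite XE.
  by rewrite E -(E z.2) -surjective_pairing.
move=> z A Uz; have := LN z A Uz.
have hd : horizontal (extd phi) z.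
  by apply: extd_fibre => // [B|B y]; [exact: dphi|exact: fc].
by rewrite lN // iota_tv_horizontal // mulrSr addrAC subrr add0r.
Qed.

End Horizontal.

(** * The Schouten bracket of the inverse of a 2-form *)

Section Schouten.
Context {R : realType} {V : normedModType R}.

Lemma derive_sumE {W : normedModType R} (I : Type) (r : seq I) (f : I -> V -> W)
    (x v : V) : (forall i, derivable (f i) x v) ->
  'D_v (fun y => \sum_(i <- r) f i y) x = \sum_(i <- r) 'D_v (f i) x.
Proof.
move=> df; suff [] : is_derive x v (fun y => \sum_(i <- r) f i y)
    (\sum_(i <- r) 'D_v (f i) x) by [].
elim: r => [|i r IH].
  have -> : (fun y => \sum_(i <- [::]) f i y) = cst 0.
    by apply/funext => y; rewrite big_nil.
  by rewrite big_nil; exact: is_derive_cst.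
have -> : (fun y => \sum_(j <- i :: r) f j y) =
    f i + (fun y => \sum_(j <- r) f j y).
  by apply/funext => y; rewrite big_cons.
by rewrite big_cons; apply: is_deriveD; exact: derivableP.
Qed.

Variables (I : finType) (e : I -> V) (x : I -> {scalar V}).
Hypothesis basisE : forall v, v = \sum_i x i v *: e i.

(** Differentiate the constant function y |-> om_y (P y d, w), with w frozen
    at P z d': this expresses the derivative of d' (P y d) by the derivative
    of om on frozen vectors. The cyclic sum in the Schouten bracket then
    becomes the exterior derivative of om. The basis e with its coordinates x
    is what allows the product rule to be applied to om_y (P y d, w). *)
Lemma schouten_inverse (U : set V) (om : form V 2) (P : bivector V) z a b c :
  open U -> U z ->
  (forall y w, U y -> scalar (fun v => om y (pairv v w))) ->
  (forall y v w, U y -> om y (pairv v w) = - om y (pairv w v)) ->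
  (forall y d v, U y -> om y (pairv (P y d) v) = d v) ->
  (forall v w, differentiable (fun y => om y (pairv v w)) z) ->
  (forall d d' : {scalar V}, differentiable (fun y => d' (P y d)) z) ->
  schouten P P z a b c =
  extd om z (triple (P z a) (P z b) (P z c)) *+ 2.
Proof.
move=> oU Uz lin alt inv dom dP.
have nU : nbhs z U by exact: open_nbhs_nbhs.
have om_sum y (k : I -> R) w : U y ->
    om y (pairv (\sum_i k i *: e i) w) = \sum_i k i * om y (pairv (e i) w).
  move=> Uy; have ly := lin y w Uy.
  pose l : {scalar V} := HB.pack (fun v => om y (pairv v w))
    (GRing.isLinear.Build R V R *%R _ ly).
  by rewrite -[LHS]/(l _) linear_sum; apply: eq_bigr => i _; rewrite linearZ.
have key v (d d' : {scalar V}) : 'D_v (fun y => d' (P y d)) z =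
    'D_v (fun y => om y (pairv (P z d) (P z d'))) z.
  set D := P z d; set D' := P z d'.
  pose f i y := x i (P y d); pose g i y := om y (pairv (e i) D').
  have df i : derivable (f i) z v by apply: diff_derivable; exact: dP.
  have dg i : derivable (g i) z v by apply: diff_derivable; exact: dom.
  (* P y d has coordinates f i y, so this is d' of its derivative along v. *)
  have -> : 'D_v (fun y => d' (P y d)) z = \sum_i 'D_v (f i) z * d' (e i).
    have -> : (fun y => d' (P y d)) = (fun y => \sum_i (f i * cst (d' (e i))) y).
      apply/funext => y; rewrite {1}(basisE (P y d)) linear_sum.
      by apply: eq_bigr => i _; rewrite linearZ.
    rewrite derive_sumE => [|i]; last by apply: derivableM => //; exact: derivable_cst.
    apply: eq_bigr => i _; rewrite deriveM ?derive_cst ?scaler0 ?add0r //.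
    exact: mulrC.
  have -> : 'D_v (fun y => om y (pairv D D')) z = \sum_i x i D * 'D_v (g i) z.
    have -> : 'D_v (fun y => om y (pairv D D')) z =
        'D_v (fun y => \sum_i (cst (x i D) * g i) y) z.
      apply: near_eq_derive; apply: filterS nU => y Uy.
      by rewrite {1}(basisE D) om_sum.
    rewrite derive_sumE => [|i]; last by apply: derivableM => //; exact: derivable_cst.
    by apply: eq_bigr => i _; rewrite deriveM // derive_cst scaler0 addr0.
  have : 'D_v (fun y => \sum_i (f i * g i) y) z = 0.
    rewrite -[RHS](derive_cst (d D') z v); apply: near_eq_derive.
    apply: filterS nU => y Uy; rewrite /cst -(inv y d D' Uy) [in RHS](basisE (P y d)).
    by rewrite om_sum.
  rewrite derive_sumE => [|i]; last exact: derivableM.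
  rewrite (eq_bigr (fun i => x i D * 'D_v (g i) z - 'D_v (f i) z * d' (e i))).
    by rewrite sumrB => /eqP; rewrite subr_eq0 => /eqP ->.
  move=> i _; rewrite deriveM //; congr (_ + _).
  by rewrite -(inv z d' (e i) Uz) alt // mulrN opprK; exact: mulrC.
have alt' v d d' : 'D_v (fun y => om y (pairv d d')) z =
    - 'D_v (fun y => om y (pairv d' d)) z.
  rewrite -deriveN; last exact: diff_derivable.
  by apply: near_eq_derive; apply: filterS nU => y; exact: alt.
rewrite /schouten !key extd2E (alt' _ (P z c) (P z a)).
set p := 'D_(P z a) _ z; set q := 'D_(P z b) _ z; set r := 'D_(P z c) _ z.
clearbody p q r; ring.
Qed.

End Schouten.

(** * Differentiability of the inverse matrix *)

Section InverseMatrix.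
Context {R : realType} {V : normedModType R}.

Lemma differentiable_bigsum (I : Type) (r : seq I) (f : I -> V -> R) z :
  (forall i, differentiable (f i) z) ->
  differentiable (fun y => \sum_(i <- r) f i y) z.
Proof.
move=> df; elim: r => [|i r IH].
  by under eq_fun do rewrite big_nil; exact: differentiable_cst.
by under eq_fun do rewrite big_cons; exact: differentiableD.
Qed.

Lemma differentiable_bigprod (I : Type) (r : seq I) (f : I -> V -> R) z :
  (forall i, differentiable (f i) z) ->
  differentiable (fun y => \prod_(i <- r) f i y) z.
Proof.
move=> df; elim: r => [|i r IH].
  by under eq_fun do rewrite big_nil; exact: differentiable_cst.
by under eq_fun do rewrite big_cons; exact: differentiableM.
Qed.

Lemma differentiable_det n (M : V -> 'M[R]_n) z :
  (forall i j, differentiable (fun y => M y i j) z) ->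
  differentiable (fun y => \det (M y)) z.
Proof.
move=> dM; apply: differentiable_bigsum => s.
by apply: differentiableM; [exact: differentiable_cst|exact: differentiable_bigprod].
Qed.

Lemma differentiable_invmx n (M : V -> 'M[R]_n) z i j :
  (forall i j, differentiable (fun y => M y i j) z) ->
  (\forall y \near z, M y \in unitmx) ->
  differentiable (fun y => invmx (M y) i j) z.
Proof.
move=> dM uM.
apply: (@near_eq_differentiable _ _ _
    (fun y => (\det (M y))^-1 * ((-1) ^+ (j + i) *
      \det (row' j (col' i (M y)))))).
  by apply: filterS uM => y uy; rewrite /invmx uy !mxE.
have uMz := nbhs_singleton uM.
apply: differentiableM.
  apply: differentiableV; first exact: differentiable_det.
  by move: uMz; rewrite unitmxE unitfE.
apply: differentiableM; first exact: differentiable_cst.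
apply: differentiable_det => k l.
by under eq_fun do rewrite !mxE; exact: dM.
Qed.

End InverseMatrix.

(** * Coordinate expressions on the tangent bundle *)

Section Coordinates.
Context {R : realType} {n : nat}.
Local Notation TV := (TV (R := R) n).

Lemma bilinE (G : 'M[R]_n) u v :
  bilin G u v = \sum_l \sum_m G l m * u 0 l * v 0 m.
Proof.
rewrite /bilin mxE exchange_big; apply: eq_bigr => m _; rewrite !mxE mulr_suml.
by apply: eq_bigr => l _; rewrite [G l m * _]mulrC.
Qed.

Lemma bilin_scalarl (G : 'M[R]_n) v : scalar (bilin G ^~ v).
Proof. by move=> k u w; rewrite /bilin !mulmxDl -!scalemxAl !mxE. Qed.

Lemma bilin_scalarr (G : 'M[R]_n) u : scalar (bilin G u).
Proof.
by move=> k v w; rewrite /bilin linearD linearZ /= mulmxDr -scalemxAr !mxE.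
Qed.

Lemma bilinBl (G : 'M[R]_n) u u' v : bilin G (u - u') v = bilin G u v - bilin G u' v.
Proof. by rewrite -scaleN1r addrC bilin_scalarl mulN1r addrC. Qed.

Lemma dx_scalar l : scalar (fun A : TV => dx l A).
Proof. by move=> k u v; rewrite /dx !mxE. Qed.
Lemma ddot_scalar l : scalar (fun A : TV => ddot l A).
Proof. by move=> k u v; rewrite /ddot !mxE. Qed.

Definition frame (i : 'I_n + 'I_n) : TV :=
  match i with inl l => pd l | inr l => pdot l end.

Definition coframe (i : 'I_n + 'I_n) : {scalar TV} :=
  match i with
  | inl l => HB.pack (fun A : TV => dx l A)
      (GRing.isLinear.Build R TV R *%R _ (dx_scalar l))
  | inr l => HB.pack (fun A : TV => ddot l A)
      (GRing.isLinear.Build R TV R *%R _ (ddot_scalar l))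
  end.

Lemma frameE (A : TV) : A = \sum_i coframe i A *: frame i.
Proof.
rewrite big_sumType /=; apply: pair_ext; rewrite /= ?fst_sum ?snd_sum /=.
  rewrite [X in _ + X]big1 => [|l _]; last by rewrite scaler0.
  by rewrite addr0 [LHS]row_sum_delta.
rewrite [X in X + _]big1 => [|l _]; last by rewrite scaler0.
by rewrite add0r [LHS]row_sum_delta.
Qed.

Lemma hlift_fst (K : TV -> 'M[R]_n) z l : (hlift K z l).1 = delta_mx 0 l.
Proof.
by rewrite /hlift /= fst_sum big1 ?addr0 // => m _ /=; rewrite scaler0.
Qed.

Lemma hlift_snd (K : TV -> 'M[R]_n) z l : (hlift K z l).2 = row l (K z).
Proof.
rewrite /hlift /= snd_sum add0r [RHS]row_sum_delta; apply: eq_bigr => m _.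
by rewrite mxE.
Qed.

Lemma hproj_fst (K : TV -> 'M[R]_n) z A : (hproj K z A).1 = A.1.
Proof.
rewrite /hproj fst_sum [RHS]row_sum_delta; apply: eq_bigr => l _.
by rewrite -(hlift_fst K z).
Qed.

Lemma hproj_snd (K : TV -> 'M[R]_n) z A : (hproj K z A).2 = A.1 *m K z.
Proof.
rewrite /hproj snd_sum mulmx_sum_row; apply: eq_bigr => l _.
by rewrite -(hlift_snd K z).
Qed.

Lemma liouvilleE (z : TV) : liouville z = (0, z.2).
Proof.
apply: pair_ext; rewrite /liouville ?fst_sum ?snd_sum.
  by rewrite big1 // => l _; rewrite /= scaler0.
by rewrite [RHS]row_sum_delta.
Qed.

End Coordinates.

Section Chart.
Context {R : realType} {n : nat} {E : topologicalType}.
Local Notation TV := (TV (R := R) n).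
Variables (c : chart (R := R) n E) (g : chart (R := R) n E -> 'rV[R]_n -> 'M[R]_n).
Variable (K : chart (R := R) n E -> TV -> 'M[R]_n).

Lemma flatE z b : flat g c z (fun=> b) = bilin (g c z.1) z.2 b.1.
Proof. by rewrite bilinE. Qed.

Lemma UpsilonE z a b : Upsilon g K c z (pairv a b) =
  bilin (g c z.1) (a.2 - a.1 *m K c z) b.1 -
  bilin (g c z.1) (b.2 - b.1 *m K c z) a.1.
Proof.
rewrite !bilinE -sumrB; apply: eq_bigr => l _.
rewrite -sumrB; apply: eq_bigr => m _; rewrite /wedge /pairv /= /dx /ddot.
have vE (B : TV) : B.2 0 l - \sum_k K c z k l * B.1 0 k =
    (B.2 - B.1 *m K c z) 0 l.
  by rewrite !mxE; congr (_ - _); apply: eq_bigr => k _; exact: mulrC.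
by rewrite !vE mulrBr !mulrA.
Qed.

Lemma open_T_image : open (T_image c).
Proof. exact: (@open_fst_preimage R 'rV[R]_n 'rV[R]_n _ (@chart_image_open R n E c)). Qed.

Hypothesis sg : smooth_on (chart_image c) (g c).
Hypothesis sK : smooth_on (T_image c) (K c).

Lemma smooth_metric_entry l m : smooth_on (T_image c) (fun z : TV => g c z.1 l m).
Proof.
apply: (smooth_on_entry _ _ open_T_image).
exact: (smooth_on_fst (@chart_image_open R n E c) sg).
Qed.

Lemma smooth_flat b : smooth_on (T_image c) (fun z : TV => flat g c z (fun=> b)).
Proof.
have oT := open_T_image.
apply: smooth_on_sum => // l; apply: smooth_on_sum => // m.
apply: smooth_onM => //; last exact: smooth_on_cst.
apply: smooth_onM => //; first exact: smooth_metric_entry.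
have sy : smooth_on (T_image c) (fun z : TV => z.2).
  have -> : (fun z : TV => z.2) = (fun z => 0 + (snd : {linear TV -> 'rV[R]_n}) z).
    by apply/funext => z; rewrite add0r.
  by apply: smooth_on_affine => // z; exact: cvg_snd.
exact: smooth_on_entry oT sy.
Qed.

Lemma smooth_Upsilon a b :
  smooth_on (T_image c) (fun z : TV => Upsilon g K c z (pairv a b)).
Proof.
have oT := open_T_image.
have sV l B : smooth_on (T_image c) (fun z => ddot l B - \sum_k K c z k l * dx k B).
  apply: smooth_onB => //; first exact: smooth_on_cst.
  apply: smooth_on_sum => // k; apply: smooth_onM => //; last exact: smooth_on_cst.
  exact: smooth_on_entry.
apply: smooth_on_sum => // l; apply: smooth_on_sum => // m.
apply: smooth_onM => //; first exact: smooth_metric_entry.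
by apply: smooth_onB => //; apply: smooth_onM => //; exact: smooth_on_cst.
Qed.

(** The derivative of the metric in the direction u, paired with the fibre
    coordinate y and with w. *)
Definition dmetric (z : TV) (u w : 'rV[R]_n) : R :=
  'D_((u, 0) : TV) (fun y : TV => bilin (g c y.1) y.2 w) z.

(** The components of the 1-form are linear along the fibres, so the vertical
    part of the derivative is the metric itself. *)
Lemma derive_flat z a b : T_image c z ->
  'D_a (fun y => flat g c y (fun=> b)) z =
  dmetric z a.1 b.1 + bilin (g c z.1) a.2 b.1.
Proof.
move=> Uz; have df : differentiable (fun y : TV => flat g c y (fun=> b)) z.
  exact: smooth_on_diff (smooth_flat b) Uz.
rewrite (_ : (fun y => _) = (fun y : TV => bilin (g c y.1) y.2 b.1)) in df *; last first.
  by apply/funext => y; exact: flatE.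
have Dv : 'D_((0, a.2) : TV) (fun y : TV => bilin (g c y.1) y.2 b.1) z =
    bilin (g c z.1) a.2 b.1.
  apply: lim_near_cst => //; near=> h => /=.
  have h0 : h != 0 by near: h; exact: nbhs_dnbhs_neq.
  rewrite scaler0 add0r bilin_scalarl addrK.
  by rewrite -[LHS]/(_ * _) mulKf.
rewrite -Dv /dmetric !deriveE // -linearD; congr ('d _ _ _).
by apply: pair_ext; rewrite /= ?addr0 ?add0r.
Unshelve. all: by end_near.
Qed.

Lemma extd_flatE z a b : T_image c z ->
  extd (flat g c) z (pairv a b) =
  (dmetric z a.1 b.1 + bilin (g c z.1) a.2 b.1) -
  (dmetric z b.1 a.1 + bilin (g c z.1) b.2 a.1).
Proof.
by move=> Uz; rewrite extd1E (derive_flat _ _ Uz) (derive_flat _ _ Uz).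
Qed.

Lemma flat_horizontal z : horizontal (flat g c) z.
Proof.
move=> A B AB; apply: eq_bigr => l _; apply: eq_bigr => m _.
by rewrite /dx AB.
Qed.

(** Only base components of a and b occur on the right: L[K] of the 1-form is
    horizontal. *)
Lemma lie_conn_flatE z a b : T_image c z ->
  lie_conn K (flat g) c z (pairv a b) =
  (dmetric z a.1 b.1 + bilin (g c z.1) (a.1 *m K c z) b.1) -
  (dmetric z b.1 a.1 + bilin (g c z.1) (b.1 *m K c z) a.1).
Proof.
move=> Uz; rewrite /lie_conn.
have dflat B : differentiable ((flat g c)^~ B) z.
  by rewrite (form1_eta B); exact: smooth_on_diff (smooth_flat _) Uz.
have N1 (y B : TV) : (hproj (K c) y B).1 = B.1 by exact: hproj_fst.
have hflat (y : TV) (_ : T_image c y) := @flat_horizontal y.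
rewrite (lie_tv_horizontal (@chart_image_open R n E c) _ N1 hflat dflat Uz).
rewrite iota_tv2E mulr1n 3?(extd_flatE _ _ Uz) !N1 !hproj_snd.
set p := dmetric _ _ _; set q := dmetric _ _ _.
set s := bilin _ a.2 _; set t := bilin _ b.2 _.
set s' := bilin _ (_ *m _) _; set t' := bilin _ (_ *m _) _.
clearbody p q s t s' t'; ring.
Qed.

(** The terms that involve the derivatives of the metric cancel. *)
Lemma Upsilon_eq z A : T_image c z ->
  Upsilon g K c z A = extd (flat g c) z A - lie_conn K (flat g) c z A.
Proof.
move=> Uz; rewrite (pairv_eta A); move: (A ord0) (A ord_max) => a b.
rewrite UpsilonE (lie_conn_flatE _ _ Uz) (extd_flatE _ _ Uz) !bilinBl.
set p := dmetric _ _ _; set q := dmetric _ _ _.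
set s := bilin _ a.2 _; set t := bilin _ b.2 _.
set s' := bilin _ (_ *m _) _; set t' := bilin _ (_ *m _) _.
clearbody p q s t s' t'; ring.
Qed.

End Chart.

(** * The symplectic and Poisson conditions in a chart *)

Section ChartTheorems.
Context {R : realType} {n : nat} {E : topologicalType}.
Local Notation TV := (TV (R := R) n).
Variables (c : chart (R := R) n E) (g : chart (R := R) n E -> 'rV[R]_n -> 'M[R]_n).
Variable (K : chart (R := R) n E -> TV -> 'M[R]_n).
Hypothesis sg : smooth_on (chart_image c) (g c).
Hypothesis sK : smooth_on (T_image c) (K c).

Lemma differentiable_Upsilon z A : T_image c z ->
  differentiable (fun y => Upsilon g K c y A) z.
Proof.
by move=> Uz; rewrite (pairv_eta A); exact: smooth_on_diff (smooth_Upsilon sg sK _ _) Uz.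
Qed.

Lemma differentiable_extd_flat z A : T_image c z ->
  differentiable (fun y => extd (flat g c) y A) z.
Proof.
move=> Uz; rewrite (pairv_eta A); move: (A ord0) (A ord_max) => a b.
rewrite (_ : (fun y => _) = 'D_a (fun y => flat g c y (fun=> b)) -
    'D_b (fun y => flat g c y (fun=> a))); last first.
  by apply/funext => y; exact: extd1E.
by apply: differentiableB; apply: smooth_on_diff Uz;
  apply: smooth_on_derive; exact: smooth_flat.
Qed.

Lemma lie_conn_flat_eq z A : T_image c z ->
  lie_conn K (flat g) c z A = extd (flat g c) z A - Upsilon g K c z A.
Proof. by move=> Uz; rewrite (Upsilon_eq K sg) // subKr. Qed.

(** By [Upsilon_eq] it is, near z, the difference of two forms with smooth
    components. *)
Lemma differentiable_lie_conn_flat z A : T_image c z ->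
  differentiable (fun y => lie_conn K (flat g) c y A) z.
Proof.
move=> Uz; apply: (@near_eq_differentiable _ _ _
    (fun y => extd (flat g c) y A - Upsilon g K c y A)).
  apply: filterS (open_nbhs_nbhs (conj (@open_T_image _ _ _ c) Uz)) => y Uy.
  by rewrite lie_conn_flat_eq.
apply: differentiableB; first exact: differentiable_extd_flat.
exact: differentiable_Upsilon.
Qed.

Lemma extd_Upsilon z A : T_image c z ->
  extd (Upsilon g K c) z A = - extd (lie_conn K (flat g) c) z A.
Proof.
move=> Uz; have oT := @open_T_image _ _ _ c.
rewrite (near_eq_extd A oT Uz (fun y B Uy => Upsilon_eq K sg B Uy)).
rewrite extdB => [|B|B]; last exact: differentiable_lie_conn_flat.
  by rewrite (extd_extd1 A oT Uz (smooth_flat sg)) sub0r.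
exact: differentiable_extd_flat.
Qed.

Lemma Upsilon_closedP :
  (forall z A, T_image c z -> extd (Upsilon g K c) z A = 0) <->
  (forall z A, T_image c z -> lie_liouville (lie_conn K (flat g)) c z A = 0) /\
  (forall z A, T_image c z -> lie_conn K (lie_conn K (flat g)) c z A = 0).
Proof.
have N1 (y B : TV) : (hproj (K c) y B).1 = B.1 by exact: hproj_fst.
have om_hor (y : TV) : T_image c y -> horizontal (lie_conn K (flat g) c) y.
  move=> Uy A B AB; rewrite (pairv_eta A) (pairv_eta B).
  by rewrite !(lie_conn_flatE K sg _ _ Uy) !AB.
have om0 (y v w : TV) : T_image c y -> v.1 = 0 ->
    lie_conn K (flat g) c y (pairv v w) = 0.
  move=> Uy v0; rewrite (lie_conn_flatE K sg _ _ Uy) /pairv /= v0.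
  have dm0 : dmetric c g y 0 w.1 = 0 by exact: derive0.
  have d0m : dmetric c g y w.1 0 = 0.
    rewrite /dmetric (_ : (fun y => _) = cst 0) ?derive_cst //.
    by apply/funext => y'; rewrite /bilin trmx0 mulmx0 mxE.
  by rewrite dm0 d0m /bilin trmx0 mulmx0 !mul0mx mxE !addr0 subrr.
have [cl1 cl2] := horizontal_closedP (@chart_image_open R n E c) N1
  (@liouvilleE R n) om0 om_hor (fun y A => @differentiable_lie_conn_flat y A).
split=> [cl|L].
  by apply: cl1 => y A Uy; rewrite -[LHS]opprK -extd_Upsilon // cl // oppr0.
by move=> z A Uz; rewrite extd_Upsilon // cl2 // oppr0.
Qed.

Hypothesis ug : forall x, chart_image c x -> g c x \in unitmx.

Lemma Upsilon_nondegenerate z a : T_image c z ->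
  (forall b, Upsilon g K c z (pairv a b) = 0) -> a = 0.
Proof.
move=> Uz U0; have ugz := ug Uz.
(* Vertical vectors b detect the base component of a. *)
have a1 : a.1 = 0.
  apply: trmx_inj; rewrite trmx0; apply: (can_inj (mulKmx ugz)).
  rewrite mulmx0; apply/colP => j; rewrite [RHS]mxE.
  have := U0 (0, delta_mx 0 j); rewrite UpsilonE /= mul0mx subr0.
  rewrite {1}/bilin trmx0 mulmx0 mxE sub0r => /eqP; rewrite oppr_eq0 => /eqP.
  by rewrite /bilin -mulmxA -rowE mxE.
(* Once that is zero, vectors b along the base detect the vertical one. *)
have a2 : a.2 = 0.
  apply: (can_inj (mulmxK ugz)); rewrite mul0mx; apply/rowP => j; rewrite [RHS]mxE.
  have := U0 (delta_mx 0 j, 0); rewrite UpsilonE /= a1 mul0mx subr0.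
  by rewrite {2}/bilin trmx0 mulmx0 mxE subr0 /bilin trmx_delta -colE mxE.
by apply: pair_ext.
Qed.

(** The summand w K makes (w, w K) horizontal, so the remaining summand is the
    vertical part that [UpsilonE] isolates. *)
Lemma LambdaE z a : Lambda g K c z a =
  let w := - (\row_m a (pdot m) *m (invmx (g c z.1))^T) in
  (w, w *m K c z + \row_l a (hlift (K c) z l) *m invmx (g c z.1)).
Proof.
rewrite /Lambda /vwedge; set G := invmx _.
have wE l : (- (\row_m a (pdot m) *m G^T)) 0 l = - \sum_m G l m * a (pdot m).
  by rewrite !mxE; congr (- _); apply: eq_bigr => m _; rewrite !mxE mulrC.
apply: pair_ext; rewrite /= ?fst_sum ?snd_sum.
  rewrite [RHS]row_sum_delta; apply: eq_bigr => l _; rewrite fst_sum wE -sumrN.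
  rewrite scaler_suml; apply: eq_bigr => m _ /=.
  rewrite -[LHS]/(G l m *: (a (hlift (K c) z l) *: 0 -
    a (pdot m) *: (hlift (K c) z l).1)).
  by rewrite hlift_fst scaler0 sub0r scalerN scalerA scaleNr.
rewrite mulmx_sum_row [X in _ + X]row_sum_delta.
have sndE l m : (G l m *: (a (hlift (K c) z l) *: pdot m -
      a (pdot m) *: hlift (K c) z l)).2 =
    (G l m * a (hlift (K c) z l)) *: delta_mx 0 m -
    (G l m * a (pdot m)) *: row l (K c z).
  rewrite -[LHS]/(G l m *: (a (hlift (K c) z l) *: delta_mx 0 m -
    a (pdot m) *: (hlift (K c) z l).2)).
  by rewrite hlift_snd scalerBr !scalerA.
under eq_bigr => l _.
  rewrite snd_sum (eq_bigr _ (fun m _ => sndE l m)) sumrB -scaler_suml.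
  over.
rewrite sumrB addrC; congr (_ + _).
  by rewrite -sumrN; apply: eq_bigr => l _; rewrite wE scaleNr.
rewrite exchange_big; apply: eq_bigr => m _; rewrite -scaler_suml; congr (_ *: _).
by rewrite mxE; apply: eq_bigr => l _; rewrite mxE mulrC.
Qed.

(** B is the sum of its horizontal projection and of a vertical vector; the
    latter is a value of the Liouville field, hence expanded in [pdot]. *)
Lemma scalar_frameE z (a : {scalar TV}) B :
  a B = (B.1 *m (\row_l a (hlift (K c) z l))^T) 0 0 +
    ((B.2 - B.1 *m K c z) *m (\row_m a (pdot m))^T) 0 0.
Proof.
have {1}-> : B = hproj (K c) z B + liouville ((0, B.2 - B.1 *m K c z) : TV).
  by apply: pair_ext; rewrite liouvilleE /= ?hproj_fst ?hproj_snd ?addr0 // addrC subrK.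
rewrite linearD !linear_sum; congr (_ + _); rewrite mxE; apply: eq_bigr => l _;
  by rewrite linearZ !mxE.
Qed.

Lemma Upsilon_Lambda z (a : {scalar TV}) b : T_image c z ->
  Upsilon g K c z (pairv (Lambda g K c z a) b) = a b.
Proof.
move=> Uz; have ugz := ug Uz.
rewrite UpsilonE LambdaE (scalar_frameE z) /= [_ + _ - _]addrAC subrr add0r /bilin.
rewrite mulmxKV // linearN /= trmx_mul trmxK mulmxN mulmxA mulmxK // [X in _ - X]mxE.
rewrite opprK; congr (_ + _).
by rewrite [LHS]mxE [RHS]mxE; apply: eq_bigr => l _; rewrite !mxE mulrC.
Qed.

Lemma Upsilon_scalar z w : scalar (fun v => Upsilon g K c z (pairv v w)).
Proof.
move=> k u v; rewrite !UpsilonE /=.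
have -> : k *: u.2 + v.2 - (k *: u.1 + v.1) *m K c z =
    k *: (u.2 - u.1 *m K c z) + (v.2 - v.1 *m K c z).
  by rewrite mulmxDl -scalemxAl scalerBr opprD addrACA.
by rewrite bilin_scalarl bilin_scalarr mulrBr opprD addrACA.
Qed.

Lemma Upsilon_alt z v w : Upsilon g K c z (pairv v w) = - Upsilon g K c z (pairv w v).
Proof. by rewrite !UpsilonE opprB. Qed.

Lemma differentiable_Lambda z (a b : {scalar TV}) : T_image c z ->
  differentiable (fun y => b (Lambda g K c y a)) z.
Proof.
move=> Uz; have oT := @open_T_image _ _ _ c.
have dh (d : {scalar TV}) l : differentiable (fun y => d (hlift (K c) y l)) z.
  have -> : (fun y => d (hlift (K c) y l)) =
      (fun y => d (pd l) + \sum_m K c y l m * d (pdot m)).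
    apply/funext => y; rewrite linearD linear_sum; congr (_ + _).
    by apply: eq_bigr => m _; rewrite linearZ.
  apply: (smooth_on_diff _ Uz); apply: smooth_onD => //; first exact: smooth_on_cst.
  apply: smooth_on_sum => // m; apply: smooth_onM => //; last exact: smooth_on_cst.
  exact: smooth_on_entry.
have -> : (fun y => b (Lambda g K c y a)) = (fun y => \sum_l \sum_m
    invmx (g c y.1) l m * (a (hlift (K c) y l) * b (pdot m) -
      a (pdot m) * b (hlift (K c) y l))).
  apply/funext => y; rewrite linear_sum; apply: eq_bigr => l _.
  rewrite linear_sum; apply: eq_bigr => m _.
  by rewrite linearZ linearB !linearZ.
apply: differentiable_bigsum => l; apply: differentiable_bigsum => m.
apply: differentiableM.
  apply: (@differentiable_invmx _ _ _ (fun y : TV => g c y.1)) => [i j|].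
    exact: smooth_on_diff (smooth_metric_entry sg i j) Uz.
  by apply: filterS (open_nbhs_nbhs (conj oT Uz)) => y; exact: ug.
by apply: differentiableB; apply: differentiableM => //; exact: differentiable_cst.
Qed.

Lemma Lambda_poisson : (forall z A, T_image c z -> extd (Upsilon g K c) z A = 0) ->
  forall z a b d, T_image c z -> schouten (Lambda g K c) (Lambda g K c) z a b d = 0.
Proof.
move=> cl z a b d Uz.
rewrite (@schouten_inverse _ _ _ (@frame R n) (@coframe R n) (@frameE R n) _ _ _ _ _ _ _
  (@open_T_image _ _ _ c) Uz
  (fun y w _ => @Upsilon_scalar y w) (fun y v w _ => @Upsilon_alt y v w)
  (fun y d v Uy => @Upsilon_Lambda y d v Uy)
  (fun v w => @differentiable_Upsilon z (pairv v w) Uz)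
  (fun a b => @differentiable_Lambda z a b Uz)).
by rewrite cl // mul0rn.
Qed.

End ChartTheorems.

(** * Spacetimes *)

Lemma minkowski_unit (R : realType) : (minkowski : 'M[R]_4) \in unitmx.
Proof.
rewrite unitmxE det_diag unitfE; apply/prodf_neq0 => i _.
by rewrite mxE; case: ifP => _; rewrite ?oppr_eq0 oner_eq0.
Qed.

Lemma lorentz_metric_unit (R : realType) (E : topologicalType)
    (M : manifold (R := R) 4 E) (g : lorentz_metric M) c x :
  atlas M c -> chart_image c x -> g c x \in unitmx.
Proof.
move=> Mc Ux; have [P _ PgP] := met_lorentz g Mc Ux.
by have := minkowski_unit R; rewrite -PgP !unitmx_mul => /andP[/andP[]].
Qed.

Theorem theorem2p5 (R : realType) (E : topologicalType)
    (S : spacetime R E) (K : connection S) :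
  (T_symplectic S (Upsilon (st_metric S) K) /\
   T_poisson S (Lambda (st_metric S) K))
  <->
  (T_vanishes S (lie_liouville (lie_conn K (flat (st_metric S)))) /\
   T_vanishes S (lie_conn K (lie_conn K (flat (st_metric S))))).
Proof.
have sg c (Sc : atlas S c) := met_smooth (st_metric S) Sc.
have sK c (Sc : atlas S c) := conn_smooth K Sc.
have ug c (Sc : atlas S c) x := @lorentz_metric_unit R E S (st_metric S) c x Sc.
have closedP c (Sc : atlas S c) := Upsilon_closedP (sg c Sc) (sK c Sc).
split=> [[[cl _] _]|[LI LK]].
  by split=> c Sc z Uz A; have [/(_ (fun z A Uz => cl c Sc z Uz A))[LI LK] _] :=
    closedP c Sc; [exact: LI|exact: LK].
have cl c (Sc : atlas S c) : forall z A, T_image c z ->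
    extd (Upsilon (st_metric S) K c) z A = 0.
  by have [_ /(_ (conj (fun z A Uz => LI c Sc z Uz A)
    (fun z A Uz => LK c Sc z Uz A)))] := closedP c Sc.
split; [split|].
- by move=> c Sc z Uz A; exact: cl.
- move=> c Sc z Uz A; exact: Upsilon_nondegenerate (ug c Sc) _ _ Uz.
- move=> c Sc z Uz a b e.
  exact: (Lambda_poisson (sg c Sc) (sK c Sc) (ug c Sc) (cl c Sc)).
Qed.
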